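(* For every positive integer $r$, $r-2 \le \pi^*(S_r) \le \Lambda^*(S_r) \le 2r + \sqrt{(16 \ln 2)r} + 11$.
   Context: For a positive integer $n$, $[n]=\{1,\dots,n\}$ and $\mathcal{B}_n$ denotes the family of all subsets of $[n]$ ordered by inclusion. A poset $P$ is a subposet of $Q$ if $P\subseteq Q$ and $x\le_P y$ iff $x\le_Q y$; a family $\mathcal{F}\subseteq\mathcal{B}_n$ contains a copy of $P$ if some subposet of $(\mathcal{F},\subseteq)$ is isomorphic to $P$, and is $P$-free otherwise. ${\rm La}^*(n,P)$ is the maximum size of a $P$-free family $\mathcal{F}\subseteq\mathcal{B}_n$, and the Turán threshold is $\pi^*(P)=\limsup_{n\to\infty}{\rm La}^*(n,P)/\binom{n}{\lfloor n/2\rfloor}$. The Lubell function of $\mathcal{F}\subseteq\mathcal{B}_n$ is $\ell(\mathcal{F})=\sum_{A\in\mathcal{F}}1/\binom{n}{|A|}$, and $\Lambda^*(P)=\sup\{\ell(\mathcal{F}) : n\ge1,\ \mathcal{F}\subseteq\mathcal{B}_n\ P\text{-free}\}$. The standard example $S_r$ is the poset on $2r$ elements $a_1,\dots,a_r,b_1,\dots,b_r$ in which $\{a_i\}$ and $\{b_j\}$ are antichains and $b_j\le a_i$ iff $i\ne j$ (no other relations). *)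

(* Defs.v *)
From HB Require Import structures.
From mathcomp Require Import all_boot all_order all_algebra.
From mathcomp Require Import all_classical all_reals all_analysis.

Set Implicit Arguments.
Unset Strict Implicit.
Unset Printing Implicit Defensive.

Import Order.TTheory GRing.Theory Num.Theory.
Local Open Scope ring_scope.

Section Posets.
Variables (d : Order.disp_t) (P : finPOrderType d).

(* The subfamily G, ordered by inclusion, is isomorphic to P. *)
Definition poset_iso n (G : {set {set 'I_n}}) : bool :=
  [exists f : {ffun P -> {set 'I_n}},
    [&& injectiveb f, [set f x | x : P] == G &
        [forall x, forall y, (f x \subset f y) == (x <= y)%O]]].

Definition contains_copy n (F : {set {set 'I_n}}) : bool :=
  [exists G : {set {set 'I_n}}, (G \subset F) && poset_iso G].

Definition poset_free n (F : {set {set 'I_n}}) : bool := ~~ contains_copy F.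

Definition La_star (n : nat) : nat :=
  \max_(F : {set {set 'I_n}} | poset_free F) #|F|.

End Posets.

Definition lubell (R : realType) n (F : {set {set 'I_n}}) : R :=
  \sum_(A in F) ('C(n, #|A|)%:R)^-1.

(* The limsup and the supremum are taken in the extended reals, so that no
   boundedness is presupposed. *)
Definition pi_star (R : realType) (d : Order.disp_t) (P : finPOrderType d) :
    \bar R :=
  limn_esup (fun n : nat => ((La_star P n)%:R / 'C(n, n./2)%:R : R)%:E).

Definition Lambda_star (R : realType) (d : Order.disp_t)
    (P : finPOrderType d) : \bar R :=
  ereal_sup [set z : \bar R | exists n (F : {set {set 'I_n}}),
    [/\ (0 < n)%N, poset_free P F & z = (lubell R F)%:E]]%classic.

(* inl i stands for a_i and inr j for b_j. *)
Definition std_example (r : nat) : Type := ('I_r + 'I_r)%type.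

HB.instance Definition _ r := Finite.on (std_example r).

Definition std_le r (x y : std_example r) : bool :=
  match x, y with
  | inl i, inl j => i == j
  | inr i, inr j => i == j
  | inr j, inl i => i != j
  | inl _, inr _ => false
  end.

Fact std_le_refl r : reflexive (@std_le r).
Proof. by case=> i /=. Qed.

Fact std_le_anti r : antisymmetric (@std_le r).
Proof.
by move=> [i|i] [j|j] //=; rewrite ?andbF // => /andP[/eqP->].
Qed.

Fact std_le_trans r : transitive (@std_le r).
Proof.
by move=> [i|i] [j|j] [k|k] //=; do ?[by move/eqP->]; do ?[by move=> + /eqP<-].
Qed.

Fact std_display : Order.disp_t. Proof. exact: (Order.Disp tt tt). Qed.

HB.instance Definition _ r := Order.Le_isPOrder.Build std_display
  (std_example r) (@std_le_refl r) (@std_le_anti r) (@std_le_trans r).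

(* Main.v *)
Require Import Defs.
From mathcomp Require Import all_boot all_order all_algebra.
From mathcomp Require Import ring lra zify.

(** Lower bound: in a copy of S_r pick x_i in b_i \ a_i. For i <> j the set a_i
    contains b_j together with the r - 2 further points x_l (l <> i, j), which
    lie outside b_j, so r - 2 consecutive layers contain no copy.

    Upper bound: work in the power set of G and let F be S_r-free. Call
    y outside B marked by B when some b in F satisfies y \in b \subset y |: B,
    and let u(B) be the proportion of unmarked y among the points outside B.
    For a fixed y, the sets b - y (y \in b \in F) together with the A in F for
    which y is unmarked form a family on G - y that embeds into F. If G is a
    smallest ground set on which the Lubell function exceeds a given bound,
    averaging over y gives sum_(A in F) u(A) / C(|G|, |A|) <= 1; the dual
    statement holds because S_r is self-dual.

    Follow a random maximal chain through G. By Doob's maximal inequality, given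
    that it passes through B, with probability at most 4 u(B) some initial
    segment of its continuation consists of unmarked points for at least a
    quarter. So on average at most 4 + 4 members of F on the chain are
    exceptional from below or from above. If B and A are two other members of F
    on the chain at distance d > 2 r, then more than d / 2 > r of the points of
    A \ B are marked both ways, and these yield a copy of S_r. Hence the Lubell
    function is at most 2 r + 9. *)

Set Implicit Arguments.
Unset Strict Implicit.
Unset Printing Implicit Defensive.

Import Order.TTheory GRing.Theory Num.Theory.
Local Open Scope ring_scope.

(** * Averages over uniformly random orderings of a finite set *)

Section Orderings.
Variables (R : realFieldType) (T : finType).
Implicit Types (G H A B U : {set T}) (s : seq T) (f g : seq T -> R).

Definition ordering G s := uniq s && ([set x in s] == G).

Lemma ordering_size G s : ordering G s -> size s = #|G|.
Proof. by case/andP=> us /eqP <-; rewrite cardsE; apply/esym/card_uniqP. Qed.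

Lemma ordering_set G s : ordering G s -> [set x in s] = G.
Proof. by case/andP=> _ /eqP. Qed.

Lemma ordering_cons G x s : x \in G -> ordering (G :\ x) s -> ordering G (x :: s).
Proof.
move=> xG /andP[us /eqP sE]; apply/andP; split.
  by rewrite /= us andbT -[x \in s](in_set (mem s)) sE !inE eqxx.
by apply/eqP; rewrite set_cons sE setD1K.
Qed.

Lemma ordering_count G U s : ordering G s -> count (mem U) s = #|U :&: G|.
Proof.
case/andP=> us /eqP <-; rewrite -size_filter.
have /card_uniqP <- : uniq [seq x <- s | mem U x] by rewrite filter_uniq.
by apply: eq_card => x; rewrite mem_filter !inE.
Qed.

Lemma card_D1 G x : x \in G -> #|G :\ x| = #|G|.-1.
Proof. by move=> xG; rewrite (cardsD1 x G) xG. Qed.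

(** The fuel [n] is meant to be [#|G|], since [G :\ x] is not a structural subterm of G. *)
Fixpoint avg_rec n G f : R :=
  if n is m.+1 then
    (\sum_(x in G) avg_rec m (G :\ x) (fun s => f (x :: s))) / #|G|%:R
  else f [::].

(* Expectation of f over a uniformly random ordering of G. *)
Definition avg G f := avg_rec #|G| G f.

Lemma avg0 f : avg set0 f = f [::].
Proof. by rewrite /avg cards0. Qed.

Lemma avg_cons G f : (0 < #|G|)%N ->
  avg G f = (\sum_(x in G) avg (G :\ x) (fun s => f (x :: s))) / #|G|%:R.
Proof.
move=> G0; rewrite {1}/avg -{1}(prednK G0) /=; congr (_ / _).
by apply: eq_bigr => x xG; rewrite /avg card_D1.
Qed.

Lemma card_ind (Q : {set T} -> Prop) :
  Q set0 ->
  (forall G, (0 < #|G|)%N -> (forall x, x \in G -> Q (G :\ x)) -> Q G) ->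
  forall G, Q G.
Proof.
move=> Q0 QS G; elim: {G}#|G| {-2}G (erefl #|G|) => [|n IH] G Gn.
  by move/cards0_eq: Gn => ->.
apply: QS => [|x xG]; first by rewrite Gn.
by apply: IH; rewrite card_D1 // Gn.
Qed.

Lemma le_avg G f g : (forall s, ordering G s -> f s <= g s) -> avg G f <= avg G g.
Proof.
elim/card_ind: G f g => [|G G0 IH] f g fg.
  by rewrite !avg0; apply: fg; apply/eqP/setP => x; rewrite !inE.
rewrite !avg_cons // ler_pM2r ?invr_gt0 ?ltr0n //; apply: ler_sum => x xG.
by apply: IH => // s sG; apply: fg; apply: ordering_cons.
Qed.

Lemma eq_avg G f g : (forall s, ordering G s -> f s = g s) -> avg G f = avg G g.
Proof.
by move=> fg; apply/eqP; rewrite eq_le !le_avg // => s sG; rewrite fg.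
Qed.

Lemma avgD G f g : avg G (fun s => f s + g s) = avg G f + avg G g.
Proof.
elim/card_ind: G f g => [|G G0 IH] f g; first by rewrite !avg0.
rewrite !avg_cons // -mulrDl -big_split /=; congr (_ / _).
by apply: eq_bigr => x xG; rewrite IH.
Qed.

Lemma avg_cst G (c : R) : avg G (fun=> c) = c.
Proof.
elim/card_ind: G => [|G G0 IH]; first by rewrite avg0.
rewrite avg_cons // (eq_bigr (fun=> c)) // sumr_const -[X in X / _]mulr_natr mulfK //.
by rewrite pnatr_eq0 -lt0n.
Qed.

Lemma avgZ G (c : R) f : avg G (fun s => c * f s) = c * avg G f.
Proof.
elim/card_ind: G f => [|G G0 IH] f; first by rewrite !avg0.
rewrite !avg_cons // mulrA mulr_sumr; congr (_ / _).
by apply: eq_bigr => x xG; rewrite IH.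
Qed.

(** Splitting off both the first and the last entry gives a double sum, whose order can be
    exchanged. *)
Lemma avg_rcons G f : (0 < #|G|)%N ->
  avg G f = (\sum_(z in G) avg (G :\ z) (fun s => f (rcons s z))) / #|G|%:R.
Proof.
elim/card_ind: G f => [|G G0 IH] f; first by rewrite cards0.
move=> _.
rewrite avg_cons //; congr (_ / _).
have [G1|G1] := leqP #|G| 1.
  have /cards1P[x ->] : #|G| == 1%N by rewrite eqn_leq G1 G0.
  by rewrite !big_set1 setDv !avg0.
have step x : x \in G -> (0 < #|G :\ x|)%N by move=> xG; rewrite card_D1 //; lia.
transitivity (\sum_(x in G) \sum_(z in G | z != x)
    avg (G :\ x :\ z) (fun s => f (x :: rcons s z)) / #|G|.-1%:R).
  apply: eq_bigr => x xG; rewrite IH ?step // mulr_suml card_D1 //.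
  by apply: eq_bigl => z; rewrite !inE andbC.
rewrite (exchange_big_dep (mem G)) /=; last by move=> x z _ /andP[].
apply: eq_bigr => z zG; rewrite avg_cons ?step // mulr_suml card_D1 //.
apply: eq_big => x; first by rewrite !inE eq_sym zG andbC.
by move=> _; rewrite setDDl setUC -setDDl.
Qed.

Lemma avg_rev G f : avg G (fun s => f (rev s)) = avg G f.
Proof.
elim/card_ind: G f => [|G G0 IH] f; first by rewrite !avg0.
rewrite avg_cons // avg_rcons //; congr (_ / _); apply: eq_bigr => x xG.
by rewrite -[RHS]IH //; apply: eq_avg => s _; rewrite rev_cons.
Qed.

(** * Lubell weights under deletion of a point *)

Definition wt G B : R := ('C(#|G|, #|B|)%:R)^-1.

Lemma wt_ge0 G B : 0 <= wt G B.
Proof. by rewrite invr_ge0 ler0n. Qed.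

Lemma wt_set0 G : wt G set0 = 1.
Proof. by rewrite /wt cards0 bin0 invr1. Qed.

(** This is k C(n, k) = n C(n - 1, k - 1) in reciprocal form; the next lemma is (n - k) C(n, k) = n
    C(n - 1, k). *)
Lemma wtD1_in G B x : B \subset G -> x \in B ->
  wt (G :\ x) (B :\ x) / #|G|%:R = wt G B / #|B|%:R.
Proof.
move=> BG xB; have xG := subsetP BG x xB.
rewrite /wt -!invfM -!natrM !card_D1 //; congr (_%:R^-1).
have B0 : (0 < #|B|)%N by apply/card_gt0P; exists x.
by rewrite mulnC mul_bin_diag prednK // mulnC.
Qed.

Lemma wtD1_notin G B x : x \in G ->
  wt (G :\ x) B / #|G|%:R = wt G B / (#|G| - #|B|)%:R.
Proof.
move=> xG; rewrite /wt -!invfM -!natrM card_D1 //; congr (_%:R^-1).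
by rewrite mulnC mul_bin_down mulnC.
Qed.

(** Reindexing by [x |: B] gives a nonempty set with a distinguished element, which [wtD1_in] makes
    uniform in that set. *)
Lemma sum_subset_cons G (h : T -> {set T} -> R) :
  (\sum_(x in G) \sum_(B : {set T} | B \subset G :\ x)
     wt (G :\ x) B * h x B) / #|G|%:R
  = \sum_(B : {set T} | (B \subset G) && (B != set0))
      wt G B * ((\sum_(x in B) h x (B :\ x)) / #|B|%:R).
Proof.
rewrite mulr_suml.
transitivity (\sum_(x in G) \sum_(B : {set T} | (B \subset G) && (x \in B))
    wt G B * (h x (B :\ x) / #|B|%:R)).
  apply: eq_bigr => x xG; rewrite mulr_suml.
  rewrite (reindex_onto (fun B : {set T} => B :\ x) (fun B => x |: B)) /=; last first.
    by move=> B; rewrite subsetD1 => /andP[_ xB]; rewrite setU1K.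
  apply: eq_big => B.
    apply/andP/andP => [[BG /eqP BE]|[BG xB]].
      rewrite -BE setU11; split=> //; rewrite subUset sub1set xG /=.
      exact: subset_trans BG (subsetDl _ _).
    by rewrite setSD // setD1K.
  case/andP=> BG /eqP BE; have xB : x \in B by rewrite -BE setU11.
  have BG' : B \subset G.
    by rewrite -BE subUset sub1set xG; apply: subset_trans BG (subsetDl _ _).
  by rewrite mulrAC wtD1_in // mulrAC mulrA.
rewrite (exchange_big_dep (fun B : {set T} => (B \subset G) && (B != set0))) /=; last first.
  by move=> x B xG /andP[-> xB]; apply/set0Pn; exists x.
apply: eq_bigr => B /andP[BG B0]; rewrite mulr_suml mulr_sumr.
by apply: eq_bigl => x; rewrite BG /= andb_idl // => /(subsetP BG).
Qed.

Lemma sum_subset_rec G (h : {set T} -> R) : (0 < #|G|)%N ->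
  \sum_(B : {set T} | B \subset G) wt G B * h B =
  h set0 + (\sum_(x in G) \sum_(B : {set T} | B \subset G :\ x)
              wt (G :\ x) B * h (x |: B)) / #|G|%:R.
Proof.
move=> G0; rewrite (bigD1 set0) ?sub0set //= wt_set0 mul1r; congr (_ + _).
rewrite (sum_subset_cons G (fun x B => h (x |: B))); apply: eq_bigr => B /andP[BG B0].
rewrite (eq_bigr (fun=> h B)) => [|x xB]; last by rewrite setD1K.
by rewrite sumr_const -[X in X / _]mulr_natr mulfK // pnatr_eq0 cards_eq0.
Qed.

(* The set of the first k elements of a random ordering is uniform among the
   k-subsets, and given that set the two parts are independent random
   orderings. *)
Lemma avg_split G (h : seq T -> seq T -> R) :
  avg G (fun s => \sum_(k < (size s).+1) h (take k s) (drop k s)) =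
  \sum_(B : {set T} | B \subset G)
     wt G B * avg B (fun s1 => avg (G :\: B) (h s1)).
Proof.
elim/card_ind: G h => [|G G0 IH] h.
  rewrite avg0 big_ord1 (big_pred1 set0) => [|B]; last by rewrite subset0.
  by rewrite wt_set0 mul1r set0D !avg0.
rewrite (bigD1 set0) ?sub0set //= wt_set0 mul1r setD0 avg0.
transitivity (avg G (h [::]) +
    avg G (fun s => \sum_(k < size s) h (take k.+1 s) (drop k.+1 s))).
  rewrite -avgD; apply: eq_avg => s _.
  by rewrite big_ord_recl take0 drop0.
congr (_ + _); rewrite avg_cons //.
rewrite [X in X / _](eq_bigr _ (fun x xG => IH x xG (fun s1 => h (x :: s1)))).
rewrite sum_subset_cons; apply: eq_bigr => B /andP[BG B0].
congr (_ * _); rewrite avg_cons ?card_gt0 //; congr (_ / _).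
apply: eq_bigr => x xB; apply: eq_avg => s _; congr (avg _ _).
by apply/setP => y; rewrite !inE; have [->|] := eqVneq y x; rewrite ?xB //= andbT.
Qed.

(** * Density of a set in the segments of a random ordering *)

(** The empty suffix is excluded, as it would satisfy the inequality trivially. Initial segments are
    handled through [rev]. *)
Fixpoint dense_suffix U s :=
  if s is _ :: s' then (size s <= 4 * count (mem U) s)%N || dense_suffix U s'
  else false.

Lemma dense_suffix_drop U s k : ~~ dense_suffix U s -> (k < size s)%N ->
  (4 * count (mem U) (drop k s) < size s - k)%N.
Proof.
elim: s k => //= x s IH [|k] /norP[]; rewrite -ltnNge /=; first by rewrite subn0.
by move=> _ /IH + ks; rewrite subSS; apply.
Qed.

(* Doob's maximal inequality: the density of U in the suffix of length d of a
   random ordering is a martingale as d decreases. *)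
Lemma avg_dense_suffix G U :
  avg G (fun s => (dense_suffix U s)%:R) <= 4 * #|U :&: G|%:R / #|G|%:R.
Proof.
elim/card_ind: G => [|G G0 IH]; first by rewrite avg0 mulr_ge0 ?invr_ge0 ?mulr_ge0 ?ler0n.
have Gn0 : 0 < #|G|%:R :> R by rewrite ltr0n.
have [dG|sG] := leqP #|G| (4 * #|U :&: G|).
  apply: (@le_trans _ _ 1); last by rewrite ler_pdivlMr // mul1r -natrM ler_nat.
  by rewrite -{2}(avg_cst G 1); apply: le_avg => s _; rewrite lern1 leq_b1.
rewrite (@eq_avg _ _ (fun s => (dense_suffix U (behead s))%:R)); last first.
  move=> [|x s] // sG' /=.
  have := ordering_size sG'; have := ordering_count U sG'.
  by rewrite /= => -> ->; rewrite leqNgt sG.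
rewrite avg_cons //= ler_pM2r ?invr_gt0 //.
apply: (@le_trans _ _ (\sum_(x in G) 4 * #|U :&: (G :\ x)|%:R / #|G|.-1%:R)).
  by apply: ler_sum => x xG; rewrite -(card_D1 xG); apply: IH.
(* Martingale step: each y in [U :&: G] survives all but one of the deletions. *)
have sumE : (\sum_(x in G) #|U :&: (G :\ x)| = #|U :&: G| * #|G|.-1)%N.
  transitivity (\sum_(x in G) \sum_(y in U :&: G | x != y) 1)%N.
    apply: eq_bigr => x xG; rewrite -sum1_card; apply: eq_bigl => y.
    by rewrite !inE (eq_sym y) -andbA [(x != y) && _]andbC.
  rewrite (exchange_big_dep (mem (U :&: G))) /=; last by move=> x y _ /andP[].
  rewrite -sum_nat_const; apply: eq_bigr => y /setIP[yU yG].
  rewrite -(card_D1 yG) -sum1_card; apply: eq_bigl => x.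
  by rewrite !inE yU yG andbC.
rewrite -mulr_suml -mulr_sumr -natr_sum sumE natrM.
(* For a one-point G the divisor is 0, and the quotient is 0 by convention. *)
have [->|g0] := eqVneq (#|G|.-1%:R : R) 0; first by rewrite !mulr0 mul0r mulr_ge0 ?ler0n.
by rewrite mulrA mulfK.
Qed.

Lemma avg_dense_prefix G U :
  avg G (fun s => (dense_suffix U (rev s))%:R) <= 4 * #|U :&: G|%:R / #|G|%:R.
Proof. by rewrite (avg_rev G (fun s => (dense_suffix U s)%:R)) avg_dense_suffix. Qed.

End Orderings.

(** * Copies of a poset, and duality *)

Section Copies.
Variable T : finType.
Implicit Types (F : {set {set T}}) (G A B : {set T}).

(** Injectivity of f follows from the equivalence, by antisymmetry in P. *)
Definition has_copy d (P : finPOrderType d) F :=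
  exists2 f : P -> {set T}, (forall x, f x \in F) &
    forall x y, (f x \subset f y) = (x <= y)%O.

Lemma has_copy_embed d (P : finPOrderType d) F1 F2 (h : {set T} -> {set T}) :
  {in F1, forall A, h A \in F2} ->
  {in F1 &, forall A B, (h A \subset h B) = (A \subset B)} ->
  has_copy P F1 -> has_copy P F2.
Proof.
move=> hF hsub [f fF fle]; exists (h \o f) => [x|x y] /=; first exact: hF.
by rewrite hsub.
Qed.

Definition dual_family G F : {set {set T}} := [set G :\: A | A in F].

Lemma setDDK G A : A \subset G -> G :\: (G :\: A) = A.
Proof. by move=> AG; rewrite setDDr setDv set0U (setIidPr AG). Qed.

Lemma setD_inj G F : F \subset powerset G ->
  {in F &, injective (fun A => G :\: A)}.
Proof.
move=> FG A B /(subsetP FG); rewrite powersetE => AG.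
move=> /(subsetP FG); rewrite powersetE => BG.
by move/(congr1 (fun X => G :\: X)); rewrite !setDDK.
Qed.

Lemma dual_familyK G F : F \subset powerset G ->
  dual_family G (dual_family G F) = F.
Proof.
move=> /subsetP FG; apply/setP => A.
apply/imsetP/idP => [[_ /imsetP[B BF ->] ->]|AF].
  by rewrite setDDK //; have := FG B BF; rewrite powersetE.
exists (G :\: A); first exact: imset_f.
by rewrite setDDK //; have := FG A AF; rewrite powersetE.
Qed.

Lemma dual_family_sub G F : dual_family G F \subset powerset G.
Proof. by apply/subsetP => _ /imsetP[A _ ->]; rewrite inE subsetDl. Qed.

(** Complementation in G reverses inclusion, and swapping a_i with b_i reverses the order of S_r. *)
Lemma dual_family_std r G F : F \subset powerset G ->
  has_copy (std_example r) (dual_family G F) -> has_copy (std_example r) F.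
Proof.
move=> FG [f fF fle].
pose sw (x : std_example r) : std_example r :=
  match x with inl i => inr i | inr i => inl i end.
exists (fun x => G :\: f (sw x)) => [x|x y].
  by rewrite -(dual_familyK FG); apply: imset_f.
have subG x' : f x' \subset G.
  by have := subsetP (dual_family_sub G F) _ (fF x'); rewrite inE.
transitivity (f (sw y) \subset f (sw x)).
  apply/idP/idP => [/(setDS G)|/(setDS G)] //.
  by rewrite !setDDK.
rewrite fle; case: x y => [i|i] [j|j] //=; rewrite /Order.le /= ?[i == j]eq_sym //.
Qed.

End Copies.

(** * Unmarked points and contraction of a family *)

Section Marks.
Variables (R : realFieldType) (T : finType).
Implicit Types (F : {set {set T}}) (G A B : {set T}).

(** The Lubell function relative to a ground set G in a fixed type, so that induction can delete
    points of G. *)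
Definition mass G F : R := \sum_(A in F) wt R G A.

Lemma mass_dual G F : F \subset powerset G -> mass G (dual_family G F) = mass G F.
Proof.
move=> FG; rewrite /mass big_imset /=; last exact: setD_inj.
apply: eq_bigr => A /(subsetP FG); rewrite inE => AG.
by rewrite /wt cardsD (setIidPr AG) bin_sub // subset_leq_card.
Qed.

Definition unmarked F G B : {set T} :=
  [set y in G :\: B | [forall b in F, (y \in b) ==> ~~ (b \subset y |: B)]].

Lemma unmarkedP F G B y : y \in G :\: B -> y \notin unmarked F G B ->
  exists2 b, b \in F & (y \in b) && (b \subset y |: B).
Proof.
move=> yGB; rewrite inE yGB /= negb_forall_in => /exists_inP[b bF].
by rewrite negb_imply negbK; exists b.
Qed.

Lemma unmarkedW F G B y b : y \in unmarked F G B -> b \in F -> y \in b ->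
  b \subset y |: B -> False.
Proof.
by rewrite inE => /andP[_ /forall_inP H] bF yb; apply/negP; move: (H b bF); rewrite yb.
Qed.

Lemma unmarked_sub F G B : unmarked F G B \subset G :\: B.
Proof. by apply/subsetP => y; rewrite inE => /andP[]. Qed.

Definition contracted F G y : {set {set T}} :=
  [set B in powerset (G :\ y) |
    (y |: B \in F) || ((B \in F) && (y \in unmarked F G B))].

Lemma in_contracted F G y B : (B \in contracted F G y) =
  (B \subset G :\ y) &&
  ((y |: B \in F) || ((B \in F) && (y \in unmarked F G B))).
Proof. by rewrite /contracted inE powersetE. Qed.

(* An A in F with y unmarked contains no b :\ y with y \in b \in F, so adding
   y back exactly to the latter sets embeds the family into F. *)
Lemma contracted_copy d (P : finPOrderType d) F G y :
  has_copy P (contracted F G y) -> has_copy P F.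
Proof.
pose h B := if y |: B \in F then y |: B else B.
apply: (@has_copy_embed _ _ _ _ _ h) => [B|A B].
  by rewrite in_contracted /h; case: ifP => //= _ /andP[_ /andP[]].
rewrite !in_contracted !subsetD1 => /andP[/andP[AG yA] HA] /andP[/andP[BG yB] HB].
have subU (C D : {set T}) : y \notin C -> (C \subset y |: D) = (C \subset D).
  move=> yC; rewrite -subDset; suff -> : C :\: [set y] = C by [].
  by apply/setDidPl; rewrite disjoint_sym disjoints1.
rewrite /h; case: ifP HA => [yAF _|_ /= /andP[AF yuA]];
  case: ifP HB => [yBF _|_ /= /andP[BF yuB]] //.
- by rewrite subUset sub1set setU11 subU.
- have -> : (y |: A \subset B) = false.
    by apply/negbTE/negP => /subsetP/(_ y); rewrite setU11 (negbTE yB) => /(_ isT).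
  apply/esym/negbTE/negP => AB.
  exact: (unmarkedW yuB yAF (setU11 _ _) (setUS _ AB)).
- by rewrite subU.
Qed.

(** The two kinds of sets in [contracted] are disjoint: if [y |: B] is in F, it marks y for B. *)
Lemma mass_contracted F G y : F \subset powerset G ->
  mass (G :\ y) (contracted F G y) =
  \sum_(B : {set T} | B \subset G :\ y) wt R (G :\ y) B * (y |: B \in F)%:R +
  \sum_(B in F | y \in unmarked F G B) wt R (G :\ y) B.
Proof.
move=> FG.
have -> : \sum_(B in F | y \in unmarked F G B) wt R (G :\ y) B =
    \sum_(B : {set T} | B \subset G :\ y)
      wt R (G :\ y) B * ((B \in F) && (y \in unmarked F G B))%:R.
  rewrite big_mkcond [RHS]big_mkcond /=; apply: eq_bigr => B _.
  case: (boolP (B \in F)) => [/(subsetP FG)|_]; rewrite ?powersetE ?mulr0 ?if_same // => BG.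
  case: (boolP (y \in unmarked F G B)) => [yu|_] /=; last by rewrite mulr0 if_same.
  rewrite mulr1.
  have := subsetP (unmarked_sub F G B) y yu; rewrite inE => /andP[yB _].
  by rewrite subsetD1 BG yB.
rewrite -big_split /= /mass.
rewrite [LHS](eq_bigl _ _ (in_contracted F G y)).
rewrite big_mkcondr; apply: eq_bigr => B BG; rewrite -mulrDr.
have [yBF|_] := boolP (y |: B \in F) => /=; last first.
  by rewrite add0r; case: ifP => _; rewrite ?mulr1 ?mulr0.
have -> : (y \in unmarked F G B) = false; last by rewrite andbF addr0 mulr1.
by apply/negP => yu; apply: (unmarkedW yu yBF (setU11 _ _) (subxx _)).
Qed.

(** Averaged over y in G, the first sum of [mass_contracted] is the mass of F without the term of
    [set0], which is at most 1; the second becomes the left side here. The whole average is at most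
    c, hence below the mass of F. *)
Lemma sum_unmarked_le1 d (P : finPOrderType d) F G (c : R) :
  F \subset powerset G -> ~ has_copy P F ->
  (forall y F', y \in G -> F' \subset powerset (G :\ y) -> ~ has_copy P F' ->
     mass (G :\ y) F' <= c) ->
  c < mass G F ->
  \sum_(A in F) wt R G A * (#|unmarked F G A|%:R / (#|G| - #|A|)%:R) <= 1.
Proof.
move=> FG Ffree IH cF.
have [G0|G0] := posnP #|G|.
  rewrite big1 ?ler01 // => A AF; have -> : unmarked F G A = set0.
    apply/eqP; rewrite -subset0 -(cards0_eq G0).
    exact: subset_trans (unmarked_sub _ _ _) (subsetDl _ _).
  by rewrite cards0 mul0r mulr0.
have Gn0 : 0 < #|G|%:R :> R by rewrite ltr0n.
have massE : mass G F = \sum_(B : {set T} | B \subset G) wt R G B * (B \in F)%:R.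
  rewrite /mass big_mkcond [RHS]big_mkcond /=; apply: eq_bigr => B _.
  case: (boolP (B \in F)) => [/(subsetP FG)|_]; rewrite ?powersetE ?mulr0 ?if_same // => ->.
  by rewrite mulr1.
have avgc : (\sum_(y in G) mass (G :\ y) (contracted F G y)) / #|G|%:R <= c.
  rewrite ler_pdivrMr // mulr_natr -sumr_const; apply: ler_sum => y yG.
  apply: IH => //; last by move/contracted_copy.
  by apply/subsetP => B; rewrite inE => /andP[].
have unmE : (\sum_(y in G) \sum_(B in F | y \in unmarked F G B)
      wt R (G :\ y) B) / #|G|%:R
    = \sum_(A in F) wt R G A * (#|unmarked F G A|%:R / (#|G| - #|A|)%:R).
  rewrite (exchange_big_dep (mem F)) /=; last by move=> y B _ /andP[].
  rewrite mulr_suml; apply: eq_bigr => B BF; rewrite mulr_suml.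
  rewrite (eq_big (mem (unmarked F G B)) (fun=> wt R G B / (#|G| - #|B|)%:R)).
  - by rewrite sumr_const -[LHS]mulr_natr; ring.
  - move=> y; rewrite BF /= andb_idl // => yu.
    by have := subsetP (unmarked_sub F G B) y yu; rewrite inE => /andP[].
  - by move=> y /andP[yG _]; rewrite wtD1_notin.
move: avgc; under eq_bigr => y _ do rewrite mass_contracted //.
rewrite big_split /= mulrDl unmE => avgc.
move: cF; rewrite massE sum_subset_rec // => cF.
have : ((set0 \in F)%:R : R) <= 1 by rewrite lern1 leq_b1.
lra.
Qed.

Lemma sum_unmarked_dual_le1 r F G (c : R) :
  F \subset powerset G -> ~ has_copy (std_example r) F ->
  (forall y F', y \in G -> F' \subset powerset (G :\ y) ->
     ~ has_copy (std_example r) F' -> mass (G :\ y) F' <= c) ->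
  c < mass G F ->
  \sum_(A in F) wt R G A *
    (#|unmarked (dual_family G F) G (G :\: A)|%:R / #|A|%:R) <= 1.
Proof.
move=> FG Ffree IH cF.
have := @sum_unmarked_le1 _ (std_example r) (dual_family G F) G c
  (dual_family_sub G F) (fun h => Ffree (dual_family_std FG h)) IH.
rewrite mass_dual // => /(_ cF); apply: le_trans.
rewrite [leRHS]big_imset /=; last exact: setD_inj.
rewrite le_eqVlt; apply/orP; left; apply/eqP.
apply: eq_bigr => A /(subsetP FG); rewrite inE => AG.
have AG' := subset_leq_card AG.
by rewrite /wt cardsD (setIidPr AG) bin_sub // subKn.
Qed.

End Marks.

(** * The upper bound on the Lubell function *)

Section UpperBound.
Variables (R : realFieldType) (T : finType).
Implicit Types (F : {set {set T}}) (G A B X : {set T}).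

(** Each chosen point e_i of X gets b_i inside [e_i |: B] and a_i containing [A :\ e_i]. For i <> j,
    b_i lies in [e_i |: B], hence in [A :\ e_j] and in a_j, while e_i lies in b_i but not in a_i. *)
Lemma std_copy_of_window r F A B X : (0 < r)%N ->
  B \subset A -> (2 < #|A :\: B|)%N -> X \subset A :\: B -> (r <= #|X|)%N ->
  (forall x, x \in X -> exists2 b, b \in F & (x \in b) && (b \subset x |: B)) ->
  (forall x, x \in X -> exists2 a, a \in F & (x \notin a) && (A :\ x \subset a)) ->
  has_copy (std_example r) F.
Proof.
move=> r0 BA AB2 XAB rX lowX upX.
pose e (i : 'I_r) : T := enum_val (widen_ord rX i).
have eX i : e i \in X by apply: enum_valP.
have e_inj i j : (e i == e j) = (i == j).
  apply/eqP/eqP => [/enum_val_inj /(congr1 val) /= ij|-> //].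
  exact: val_inj.
have low i : exists b, [&& b \in F, e i \in b & b \subset e i |: B].
  by have [b bF H] := lowX _ (eX i); exists b; rewrite bF.
have up i : exists a, [&& a \in F, e i \notin a & A :\ e i \subset a].
  by have [a aF H] := upX _ (eX i); exists a; rewrite aF.
pose b i := xchoose (low i); pose a i := xchoose (up i).
have bP i : [/\ b i \in F, e i \in b i & b i \subset e i |: B].
  by apply/and3P; apply: (xchooseP (low i)).
have aP i : [/\ a i \in F, e i \notin a i & A :\ e i \subset a i].
  by apply/and3P; apply: (xchooseP (up i)).
have eA i : e i \in A by have := subsetP XAB _ (eX i); rewrite inE => /andP[].
have eB i : e i \notin B by have := subsetP XAB _ (eX i); rewrite inE => /andP[].
exists (fun x : std_example r => match x with inl i => a i | inr i => b i end).
  by case=> i; [case: (aP i) | case: (bP i)].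
have notin_b i j : i != j -> e i \notin b j.
  move=> ij; have [_ _ /subsetP bj] := bP j; apply/negP => /bj.
  by rewrite !inE e_inj (negbTE ij) (negbTE (eB i)).
have in_a i j : i != j -> e i \in a j.
  move=> ij; have [_ _ /subsetP aj] := aP j; apply: aj.
  by rewrite !inE e_inj ij eA.
case=> i [] j; rewrite {1}/Order.le /=.
- have [->|ij] := eqVneq i j; first exact: subxx.
  apply/negbTE/negP => /subsetP/(_ (e j)); rewrite in_a 1?eq_sym //.
  by have [_ /negbTE -> _] := aP j => /(_ isT).
(* Otherwise [A :\ e i] would lie in [e j |: B], so that A would have at most two points more than
   B. *)
- apply/negbTE/negP => ab; have [_ _ ai] := aP i; have [_ _ bj] := bP j.
  have := subset_leq_card (subset_trans (subset_trans ai ab) bj).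
  have := cardsD1 (e i) A; rewrite eA cardsU1 eB.
  by move: AB2; rewrite cardsD (setIidPr BA); lia.
- have [->|ij] := eqVneq j i.
    apply/negbTE/negP => /subsetP/(_ (e i)).
    by have [_ -> _] := bP i; have [_ /negbTE -> _] := aP i => /(_ isT).
  have [_ _ bi] := bP i; have [_ _ aj] := aP j.
  apply: subset_trans bi _; apply: subset_trans aj.
  rewrite subUset sub1set !inE e_inj eq_sym ij eA subsetD1 BA.
  exact: eB.
- have [->|ij] := eqVneq i j; first exact: subxx.
  apply/negbTE/negP => /subsetP/(_ (e i)); have [_ -> _] := bP i.
  by rewrite (negbTE (notin_b _ _ ij)) => /(_ isT).
Qed.

(** The chain of s meets F at step k in a member that is exceptional neither from below nor from
    above. Segments going up from A begin [drop k s], hence the [rev]; those going down from A end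
    [take k s]. *)
Definition sparse_hit F G s k :=
  let A := [set x in take k s] in
  [&& A \in F, ~~ dense_suffix (unmarked F G A) (rev (drop k s)) &
      ~~ dense_suffix (unmarked (dual_family G F) G (G :\: A)) (take k s)].

(** The entries w between steps j and k begin [drop j s] and end [take k s], so fewer than a quarter
    of them are unmarked in either sense. With k - j at least 2 r + 1, more than r points are marked
    both ways. *)
Lemma sparse_hits_close r F G s j k : (0 < r)%N -> F \subset powerset G ->
  ~ has_copy (std_example r) F -> ordering G s ->
  sparse_hit F G s j -> sparse_hit F G s k -> (k <= size s)%N ->
  (k < j + 2 * r + 1)%N.
Proof.
move=> r0 FG Ffree /andP[us /eqP sG] /and3P[_ jlow _] /and3P[_ _ kup] ks.
rewrite ltnNge; apply/negP => jk; apply: Ffree.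
set B := [set x in take j s] in jlow; set A := [set x in take k s] in kup.
set w := drop j (take k s).
have tk : take k s = take j s ++ w.
  by rewrite -{1}(cat_take_drop j (take k s)) take_takel //; lia.
have sw : size w = (k - j)%N by rewrite size_drop size_takel.
have := us; rewrite -(cat_take_drop k s) tk cat_uniq => /and3P[utk _ _].
move: utk; rewrite cat_uniq => /and3P[_ /hasPn wj uw].
have wE : [set x in w] = A :\: B.
  apply/setP => x; rewrite !inE tk mem_cat.
  by have [/wj/negbTE /= ->|_] := boolP (x \in w); rewrite ?orbT ?orbF ?andNb.
have cw : #|A :\: B| = (k - j)%N by rewrite -wE cardsE -sw; apply/card_uniqP.
have BA : B \subset A.
  by apply/subsetP => x; rewrite !inE tk mem_cat => ->.
have AG : A \subset G.
  by apply/subsetP => x; rewrite inE -sG inE => /mem_take.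
have cnt (U : {set T}) : count (mem U) w = #|U :&: (A :\: B)|.
  by apply: ordering_count; rewrite /ordering uw wE eqxx.
pose U1 := unmarked F G B; pose U2 := unmarked (dual_family G F) G (G :\: A).
have low : (4 * #|U1 :&: (A :\: B)| < k - j)%N.
  have wt' : w = take (k - j) (drop j s) by rewrite take_drop subnK //; lia.
  have := dense_suffix_drop jlow (k := size (drop j s) - (k - j)).
  rewrite size_rev drop_rev count_rev subKn ?size_drop; last by lia.
  by rewrite -wt' cnt -/U1; apply; lia.
have up : (4 * #|U2 :&: (A :\: B)| < k - j)%N.
  have := dense_suffix_drop kup (k := j); rewrite size_takel // -/w cnt; apply; lia.
apply: (@std_copy_of_window _ _ A B ((A :\: B) :\: (U1 :|: U2))) => //.
- by rewrite cw; lia.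
- exact: subsetDl.
- have := cardsID (U1 :|: U2) (A :\: B); rewrite cw setIUr.
  have [+ _] := leq_card_setU ((A :\: B) :&: U1) ((A :\: B) :&: U2).
  by rewrite ![_ :&: U1]setIC ![_ :&: U2]setIC; lia.
- move=> x; rewrite in_setD in_setU negb_or => /andP[/andP[xU1 _]].
  rewrite in_setD => /andP[xB xA].
  by apply: (unmarkedP _ xU1); rewrite in_setD xB (subsetP AG).
- move=> x; rewrite in_setD in_setU negb_or => /andP[/andP[_ xU2]].
  rewrite in_setD => /andP[xB xA].
  have xG := subsetP AG x xA.
  (* A dual mark [G :\: a] contains x and lies in [x |: (G :\: A)]: thus a misses x and contains
     [A :\ x]. *)
  have [|_ /imsetP[a aF ->]] := unmarkedP _ xU2; first by rewrite !in_setD xA xG.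
  rewrite in_setD xG andbT => /andP[xa sub]; exists a; rewrite ?xa //=.
  apply/subsetP => y; rewrite in_setD1 => /andP[yx yA]; apply/negPn/negP => ya.
  have := subsetP sub y; rewrite in_setU1 !in_setD ya (subsetP AG y yA) (negbTE yx) yA /=.
  by move=> /(_ isT).
Qed.

Lemma card_close_ord n D (Q : pred 'I_n) :
  (forall i j, Q i -> Q j -> (j < i + D)%N) -> (#|Q| <= D)%N.
Proof.
move=> close; have [i0 Qi0|Q0] := pickP Q; last by rewrite eq_card0.
have [i Qi imin] := arg_minnP val Qi0.
pose h (j : 'I_n) := (j - i)%N.
have h_inj : {in Q &, injective h}.
  move=> j k Qj Qk; rewrite /h => jk; apply: val_inj => /=.
  by have := imin j Qj; have := imin k Qk; move: jk => /=; lia.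
rewrite cardE -(size_map h) -[leqRHS](size_iota 0); apply: uniq_leq_size.
  by rewrite map_inj_in_uniq ?enum_uniq // => j k; rewrite !mem_enum; apply: h_inj.
move=> m /mapP[j]; rewrite mem_enum mem_iota => Qj ->.
by have := close i j Qi Qj; have := imin j Qj; rewrite /h /=; lia.
Qed.

Lemma mass_le r F G : (0 < r)%N -> F \subset powerset G ->
  ~ has_copy (std_example r) F -> mass R G F <= (2 * r + 9)%:R.
Proof.
move=> r0; elim/card_ind: G F => [|G G0 IH] F FG Ffree.
  apply: (@le_trans _ _ #|F|%:R); last first.
    by rewrite ler_nat (leq_trans (subset_leq_card FG)) // card_powerset cards0 expn0; lia.
  rewrite /mass -sumr_const; apply: ler_sum => A /(subsetP FG).
  by rewrite powersetE subset0 => /eqP ->; rewrite wt_set0.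
rewrite leNgt; apply/negP => big.
have IH' y F' : y \in G -> F' \subset powerset (G :\ y) ->
    ~ has_copy (std_example r) F' -> mass R (G :\ y) F' <= (2 * r + 9)%:R.
  by move=> yG; apply: IH.
have low1 := sum_unmarked_le1 FG Ffree IH' big.
have up1 := sum_unmarked_dual_le1 FG Ffree IH' big.
(* [hit] records a member of F on the chain, [lo] and [hi] the exceptional ones of the two sorts;
   [S] is the expected total along a random chain. *)
pose hit (s1 s2 : seq T) : R := ([set x in s1] \in F)%:R.
pose lo (s1 s2 : seq T) : R := ([set x in s1] \in F)%:R *
  (dense_suffix (unmarked F G [set x in s1]) (rev s2))%:R.
pose hi (s1 s2 : seq T) : R := ([set x in s1] \in F)%:R *
  (dense_suffix (unmarked (dual_family G F) G (G :\: [set x in s1])) s1)%:R.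
pose S h := avg G (fun s => \sum_(k < (size s).+1) h (take k s) (drop k s)) : R.
have sumF (h : {set T} -> R) :
    \sum_(B : {set T} | B \subset G) wt R G B * ((B \in F)%:R * h B) =
    \sum_(B in F) wt R G B * h B.
  rewrite big_mkcond [RHS]big_mkcond /=; apply: eq_bigr => B _.
  case: (boolP (B \in F)) => [/(subsetP FG)|_]; rewrite ?powersetE.
    by move=> ->; rewrite mul1r.
  by rewrite mul0r mulr0 if_same.
have Shit : S hit = mass R G F.
  rewrite /S avg_split /mass -[RHS](eq_bigr _ (fun B _ => mulr1 _)) -sumF.
  apply: eq_bigr => B BG; congr (_ * _); rewrite mulr1 -[RHS](avg_cst B).
  by apply: eq_avg => s1 /ordering_set s1B; rewrite avg_cst /hit s1B.
have Slo : S lo <= 4.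
  rewrite /S avg_split.
  apply: le_trans (_ : 4 * \sum_(A in F) wt R G A *
    (#|unmarked F G A|%:R / (#|G| - #|A|)%:R) <= _); last by lra.
  rewrite mulr_sumr -(eq_bigr _ (fun B _ => mulrCA _ _ _)) -sumF.
  apply: ler_sum => B BG; rewrite ler_wpM2l ?wt_ge0 //.
  rewrite -[leRHS](avg_cst B); apply: le_avg => s1 /ordering_set s1B.
  rewrite /lo s1B avgZ ler_wpM2l ?ler0n //.
  apply: le_trans (avg_dense_prefix _ _ _) _.
  by rewrite (setIidPl (unmarked_sub F G B)) cardsD (setIidPr BG) mulrA.
have Shi : S hi <= 4.
  rewrite /S avg_split.
  apply: le_trans (_ : 4 * \sum_(A in F) wt R G A *
    (#|unmarked (dual_family G F) G (G :\: A)|%:R / #|A|%:R) <= _); last by lra.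
  rewrite mulr_sumr -(eq_bigr _ (fun B _ => mulrCA _ _ _)) -sumF.
  apply: ler_sum => B BG; rewrite ler_wpM2l ?wt_ge0 //.
  apply: le_trans (_ : avg B (fun s1 => (B \in F)%:R * (dense_suffix
    (unmarked (dual_family G F) G (G :\: B)) s1)%:R) <= _).
    by apply: le_avg => s1 /ordering_set s1B; rewrite avg_cst /hi s1B.
  rewrite avgZ ler_wpM2l ?ler0n //.
  apply: le_trans (avg_dense_suffix _ _ _) _; rewrite mulrA.
  rewrite ler_wpM2r ?invr_ge0 ?ler0n // ler_wpM2l ?ler0n // ler_nat.
  exact/subset_leq_card/subsetIl.
(* Chain by chain, each hit is sparse or counted by [lo] or [hi], and the sparse ones lie in a
   window of 2 r + 1 indices. *)
have : S hit <= (2 * r + 1)%:R + (S lo + S hi).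
  rewrite /S -avgD -(avg_cst G (2 * r + 1)%:R) -avgD; apply: le_avg => s sG.
  rewrite -big_split /=.
  have : \sum_(k < (size s).+1) (sparse_hit F G s k)%:R <= (2 * r + 1)%:R :> R.
    rewrite -natr_sum ler_nat -big_mkcond /= sum1_card.
    apply: card_close_ord => i j Qi Qj; rewrite addnA.
    by apply: sparse_hits_close Qi Qj _ => //; rewrite -ltnS ltn_ord.
  move=> close; rewrite -lerBlDr; apply: le_trans close.
  rewrite -sumrB; apply: ler_sum => k _; rewrite /sparse_hit /hit /lo /hi.
  case: (_ \in F); last by rewrite /= !mul0r; lra.
  by do 2!case: dense_suffix; rewrite /= ?mul1r; lra.
rewrite Shit => Sle; move: big; apply/negP; rewrite -leNgt (le_trans Sle) //.
rewrite !natrD; lra.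
Qed.

End UpperBound.

(** * Agreement with the definition of copies by isomorphism *)

Section FamiliesOfSubsets.
Variables (d : Order.disp_t) (P : finPOrderType d) (n : nat).
Implicit Types F : {set {set 'I_n}}.

Lemma contains_copyP F : reflect (has_copy P F) (contains_copy P F).
Proof.
apply: (iffP existsP) => [[H /andP[HF /existsP[f]]]|[f fF fle]].
  case/and3P=> _ /eqP fH /forallP fle; exists f => [x|x y].
    by apply: (subsetP HF); rewrite -fH imset_f.
  exact/eqP/(forallP (fle x)).
have f_inj : injective f.
  by move=> x y fxy; apply: le_anti; rewrite -!fle fxy subxx.
exists [set f x | x : P]; apply/andP; split.
  by apply/subsetP => _ /imsetP[x _ ->].
apply/existsP; exists (finfun f); apply/and3P; split.
- by apply/injectiveP => x y; rewrite !ffunE => /f_inj.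
- by apply/eqP/eq_imset => x; rewrite ffunE.
- by apply/forallP => x; apply/forallP => y; rewrite !ffunE fle.
Qed.

Lemma poset_freeP F : reflect (~ has_copy P F) (poset_free P F).
Proof. by apply: (iffP negP) => H /contains_copyP. Qed.

End FamiliesOfSubsets.

(** * Middle layers for the lower bound *)

Lemma std_copy_gap r (T : finType) (F : {set {set T}}) : (1 < r)%N ->
  has_copy (std_example r) F ->
  exists A B : {set T}, [/\ A \in F, B \in F & (#|B| + (r - 2) <= #|A|)%N].
Proof.
move=> r1 [f fF fle].
pose i := Ordinal (ltnW r1); pose j := Ordinal r1.
pose a l := f (inl l); pose b l := f (inr l).
have ba (l m : 'I_r) : (b l \subset a m) = (m != l) by rewrite fle.
have xP l : exists x, (x \in b l) && (x \notin a l).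
  by have := ba l l; rewrite eqxx => /negbT/subsetPn[x xb xa]; exists x; rewrite xb.
pose x l := xchoose (xP l).
have xb l : x l \in b l by case/andP: (xchooseP (xP l)).
have xa l : x l \notin a l by case/andP: (xchooseP (xP l)).
(* For m <> l the set b_l lies in a_m, which misses x_m; this also makes the points distinct. *)
have xbn l m : m != l -> x m \notin b l.
  by move=> lm; apply: contra (xa m); apply: subsetP; rewrite ba.
have x_inj : injective x.
  by move=> l m xlm; apply/eqP; apply: contraT => lm; have := xbn _ _ lm; rewrite xlm xb.
exists (a i), (b j); split; [exact: fF|exact: fF|].
pose X := x @: ~: [set i; j].
have cX : #|X| = (r - 2)%N.
  rewrite card_imset // cardsCs setCK card_ord cards2.
  by have -> : i != j by [].
have dX : [disjoint b j & X].
  rewrite disjoint_sym; apply/pred0P => y /=; apply/negP => /andP[/imsetP[l + ->]].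
  by rewrite !inE negb_or => /andP[_ /xbn/negbTE ->].
have [_] := leq_card_setU (b j) X; rewrite dX -cX => /eqP <-.
apply: subset_leq_card; rewrite subUset ba /=; apply/subsetP => _ /imsetP[l + ->].
by rewrite !inE negb_or => /andP[li _]; apply: (subsetP _ _ (xb l)); rewrite ba eq_sym.
Qed.

(** The layers start at the middle and go up, so that their sizes never increase. *)
Definition mid_layers n k : {set {set 'I_n}} :=
  [set A : {set 'I_n} | (n./2 <= #|A| < n./2 + k)%N].

Lemma mid_layers_free n r : (2 < r)%N ->
  poset_free (std_example r) (mid_layers n (r - 2)).
Proof.
move=> r2; apply/poset_freeP => /std_copy_gap[|A [B []]]; first by lia.
by rewrite !inE; lia.
Qed.

Lemma card_mid_layers n k :
  #|mid_layers n k| = (\sum_(j < k) 'C(n, n./2 + j))%N.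
Proof.
elim: k => [|k IH].
  by rewrite big_ord0; apply: eq_card0 => A; rewrite inE addn0 ltnNge andbN.
have binE : 'C(n, n./2 + k) = #|[set A : {set 'I_n} | #|A| == (n./2 + k)%N]|.
  by rewrite card_draws card_ord.
rewrite big_ord_recr /= -IH binE.
rewrite -(cardsID (mid_layers n k) (mid_layers n k.+1)); congr (_ + _)%N; apply: eq_card => A.
  by rewrite !inE; lia.
by rewrite !inE; lia.
Qed.

Lemma bin_upper_half n j : ('C(n, (n./2 + j).+1) <= 'C(n, n./2 + j))%N.
Proof.
rewrite -(@leq_pmul2l (n./2 + j).+1) // mul_bin_left leq_mul2r.
by apply/orP; right; lia.
Qed.

Lemma bin_half_add n j : ('C(n, n./2 + j) <= 'C(n, n./2))%N.
Proof.
elim: j => [|j]; first by rewrite addn0.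
by apply: leq_trans; rewrite addnS bin_upper_half.
Qed.

Lemma bin_le_half n k : ('C(n, k) <= 'C(n, n./2))%N.
Proof.
have [nk|kn] := ltnP n k; first by rewrite bin_small.
have [hk|kh] := leqP n./2 k; first by rewrite -(subnKC hk) bin_half_add.
rewrite -bin_sub //; have hk : (n./2 <= n - k)%N by lia.
by rewrite -(subnKC hk) bin_half_add.
Qed.

(* Limits, suprema and the final bounds *)
From mathcomp Require Import all_classical all_reals all_analysis.

Import Order.TTheory GRing.Theory Num.Theory.
Import numFieldNormedType.Exports.
Local Open Scope ring_scope.

Section Thresholds.
Variable R : realType.

(** With m = [n./2], going from layer m + j to the next multiplies the binomial by at least (m - j)
    / (m + j + 1), a loss of at most (2 j + 1) / (m + 1) times the middle one; these odd numbers sum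
    to j ^ 2. *)
Lemma bin_half_add_ge n j :
  'C(n, n./2)%:R * (1 - (j ^ 2)%:R / n./2.+1%:R) <= 'C(n, n./2 + j)%:R :> R.
Proof.
set m := n./2; have m0 : 0 < m.+1%:R :> R by rewrite ltr0n.
elim: j => [|j IH]; first by rewrite mul0r subr0 mulr1 addn0.
rewrite addnS; set c0 : R := 'C(n, m)%:R in IH *.
set c : R := 'C(n, m + j)%:R in IH; set c' : R := _%:R.
have c0c : c <= c0 by rewrite ler_nat bin_half_add.
have cge0 : 0 <= c by rewrite ler0n.
have : (m + j).+1%:R * c' = (n - (m + j))%:R * c by rewrite -!natrM mul_bin_left.
have nm : m%:R - j%:R <= (n - (m + j))%:R :> R.
  by rewrite lerBlDr -natrD ler_nat /m; lia.
move=> rec; have {}rec : c * (m%:R - j%:R) <= c' * (m + j).+1%:R.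
  by rewrite [leRHS]mulrC rec mulrC ler_wpM2r.
have step : c - c0 * ((2 * j + 1)%:R / m.+1%:R) <= c'.
  have mj0 : 0 < (m + j).+1%:R :> R by rewrite ltr0n.
  apply: (@le_trans _ _ (c * (m%:R - j%:R) / (m + j).+1%:R)); last first.
    by rewrite ler_pdivrMr.
  rewrite lerBlDr -lerBlDl.
  have -> : c - c * (m%:R - j%:R) / (m + j).+1%:R =
      c * ((2 * j + 1)%:R / (m + j).+1%:R).
    rewrite natrD natrM; move: mj0; rewrite -natr1 natrD => mj0.
    by field; rewrite gt_eqF.
  apply: ler_pM => //.
  rewrite ler_wpM2l ?ler0n // lef_pV2 ?posrE // ler_nat; lia.
apply: le_trans step; apply: le_trans (lerB IH (lexx _)).
have -> : (j.+1 ^ 2 = j ^ 2 + (2 * j + 1))%N by lia.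
rewrite natrD le_eqVlt; apply/orP; left; apply/eqP; ring.
Qed.

(** Each of the k = r - 2 layers loses at most a fraction k ^ 2 / ([n./2] + 1) of the middle
    binomial, which is at most 2 k ^ 2 / (n + 1); [harmonic n] is 1 / (n + 1). *)
Lemma La_star_std_ge n r : (2 < r)%N ->
  (r - 2)%:R - 2 * ((r - 2) ^ 3)%:R * harmonic n
  <= (La_star (std_example r) n)%:R / 'C(n, n./2)%:R :> R.
Proof.
move=> r2; set k := (r - 2)%N.
have c0 : 0 < 'C(n, n./2)%:R :> R by rewrite ltr0n bin_gt0; lia.
rewrite ler_pdivlMr //.
apply: (@le_trans _ _ #|mid_layers n k|%:R); last first.
  by rewrite ler_nat; apply: leq_bigmax_cond; apply: mid_layers_free.
rewrite card_mid_layers natr_sum.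
apply: (@le_trans _ _ (\sum_(j < k)
    'C(n, n./2)%:R * (1 - 2 * (k ^ 2)%:R * harmonic n))).
  rewrite sumr_const card_ord -[leRHS]mulr_natr expnSr.
  rewrite natrM le_eqVlt; apply/orP; left; apply/eqP; ring.
apply: ler_sum => j _; apply: le_trans (bin_half_add_ge n j).
rewrite ler_wpM2l ?ler0n // lerB // /harmonic /=.
rewrite ler_pdivrMr ?ltr0n // mulrAC ler_pdivlMr ?ltr0n //.
rewrite -!natrM ler_nat.
have : (j ^ 2 <= k ^ 2)%N by rewrite leq_exp2r // ltnW.
have : (n.+1 <= 2 * n./2.+1)%N by lia.
by move=> h1 h2; apply: leq_trans (leq_mul h2 h1) _; lia.
Qed.

Lemma pi_star_std_ge r : (0 < r)%N ->
  ((r%:R - 2 : R)%:E <= pi_star R (std_example r))%E.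
Proof.
move=> r0; rewrite /pi_star limn_esup_lim; set u := fun n : nat => _.
have u_esups n : (u n <= esups u n)%E.
  by apply: ereal_sup_ubound; exists n => //=.
(* For r <= 2 the claimed bound is at most 0; for larger r the natural subtraction r - 2 is
   exact. *)
have [r2|r2] := leqP r 2.
  apply: (@le_trans _ _ 0%E); first by rewrite lee_fin subr_le0 ler_nat.
  apply: lime_ge; first exact: is_cvg_esups.
  apply: nearW => n; apply: le_trans (u_esups n).
  by rewrite lee_fin divr_ge0 ?ler0n.
pose v n : R := (r - 2)%:R - 2 * ((r - 2) ^ 3)%:R * harmonic n.
have v_cvg : (v @ \oo --> (r%:R - 2 : R)%R)%classic.
  have -> : r%:R - 2 = (r - 2)%:R - 2 * ((r - 2) ^ 3)%:R * 0 :> R.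
    by rewrite mulr0 subr0 natrB // ltnW.
  by apply: cvgB; [exact: cvg_cst|apply: cvgM; [exact: cvg_cst|exact: cvg_harmonic]].
have Ev_cvg : ((EFin \o v) @ \oo --> (r%:R - 2 : R)%R%:E)%classic.
  by apply: cvg_EFin => //; exact: nearW.
rewrite -(cvg_lim _ Ev_cvg) //; apply: lee_lim.
- by apply/cvg_ex; eexists; exact: Ev_cvg.
- exact: is_cvg_esups.
- by apply: nearW => n; apply: le_trans (u_esups n); rewrite lee_fin La_star_std_ge.
Qed.

Lemma card_le_lubell n (F : {set {set 'I_n}}) :
  #|F|%:R / 'C(n, n./2)%:R <= lubell R F.
Proof.
rewrite -sum1_card natr_sum mulr_suml; apply: ler_sum => A _.
rewrite mul1r lef_pV2 ?posrE ?ltr0n ?bin_gt0 ?ler_nat ?bin_le_half //.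
  by lia.
by rewrite -[leqRHS](card_ord n) max_card.
Qed.

(** The middle binomial is the largest, so the Lubell function dominates the normalized size. An
    element of P makes the empty family P-free, so the maximum in [La_star] is attained. *)
Lemma pi_star_le_Lambda_star d (P : finPOrderType d) : P ->
  (pi_star R P <= Lambda_star R P)%E.
Proof.
move=> x0; rewrite /pi_star limn_esup_lim; apply: lime_le; first exact: is_cvg_esups.
(* Index 0 is skipped because [Lambda_star] ranges over positive n. *)
exists 1%N => // n /= n0; apply: ub_ereal_sup => _ [m /= nm <-].
have free0 : poset_free P (finset.set0 : {set {set 'I_m}}).
  by apply/poset_freeP => -[f /(_ x0)]; rewrite inE.
have [F Ffree FLa] :
    {F : {set {set 'I_m}} | poset_free P F & La_star P m = #|F|}.
  by apply: eq_bigmax_cond; apply/card_gt0P; exists finset.set0.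
apply: le_trans (_ : ((lubell R F)%:E <= _)%E).
  by rewrite lee_fin FLa card_le_lubell.
by apply: ereal_sup_ubound; exists m, F; split=> //; apply: leq_trans nm.
Qed.

Lemma lubell_mass n (F : {set {set 'I_n}}) : lubell R F = mass R finset.setT F.
Proof. by apply: eq_bigr => A _; rewrite /wt cardsT card_ord. Qed.

End Thresholds.

Theorem theorem3p11 (R : realType) (r : nat) (hr : (0 < r)%N) :
  [/\ ((r%:R - 2 : R)%:E <= pi_star R (std_example r))%E,
      (pi_star R (std_example r) <= Lambda_star R (std_example r))%E
    & (Lambda_star R (std_example r) <=
        (2 * r%:R + Num.sqrt ((16 * ln 2) * r%:R) + 11 : R)%:E)%E].
Proof.
split; first exact: pi_star_std_ge.
  exact: (pi_star_le_Lambda_star R (inl (Ordinal hr) : std_example r)).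
apply: ub_ereal_sup => _ [n [F [n0 /poset_freeP Ffree ->]]].
rewrite lee_fin lubell_mass (le_trans (mass_le R hr _ Ffree)) //.
  by apply/fintype.subsetP => A _; rewrite powersetE finset.subsetT.
(* What remains is that 9 is at most the square root plus 11. *)
rewrite natrD natrM -addrA lerD2l.
by have := sqrtr_ge0 (16 * ln 2 * r%:R : R); lra.
Qed.
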